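(* All infinite subdirectly irreducible $2$-reductive medial quandles are isomorphic to $\mathcal{SIQ}(\mathbb{Z}_{p^\infty},1,C)$, where $p$ is a prime and $C$ is an infinite subset of the Prüfer group $\mathbb{Z}_{p^\infty}$. There are $2^{\omega}$ (i.e. continuum many) isomorphism classes of such quandles.
   Context: A quandle is an algebra $(Q,\ast,\backslash)$ with two binary operations such that for all $x,y,z\in Q$: $x\ast x=x$; $x\ast(y\ast z)=(x\ast y)\ast(x\ast z)$; $x\backslash(x\ast y)=y=x\ast(x\backslash y)$. It is medial if for all $x,y,u,v$: $(x\ast y)\ast(u\ast v)=(x\ast u)\ast(y\ast v)$, $(x\backslash y)\backslash(u\backslash v)=(x\backslash u)\backslash(y\backslash v)$ and $(x\backslash y)\ast(u\backslash v)=(x\ast u)\backslash(y\ast v)$. A quandle is $2$-reductive if it satisfies $(x\ast y)\ast y\approx y$. An algebra is subdirectly irreducible if the intersection of all its non-trivial congruences (congruences different from equality) is non-trivial. Construction $\mathcal{SIQ}(A,t,C)$: let $A$ be an abelian group with an automorphism $t$, regarded as a $\mathbb{Z}[t,t^{-1}]$-module, which is subdirectly irreducible as a module and such that $\varphi=1-t$ is not injective; let $C\subseteq A$ be a set whose distinct elements lie in distinct cosets of $\varphi(A)$ and such that $C\cup\varphi(A)$ generates $A$. Then $\mathcal{SIQ}(A,t,C)$ is the disjoint union $A\cup(\varphi(A)\times C)$ with the operation $a\ast b=\varphi(a)+t\cdot b$ for $a,b\in A$; $(a,i)\ast(b,j)=(\varphi(a+i-j)+t\cdot b,j)$ for $a,b\in\varphi(A)$,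 $i,j\in C$; $(a,i)\ast b=a+t\cdot b+i$ for $a\in\varphi(A)$, $i\in C$, $b\in A$; $a\ast(b,j)=(\varphi(\varphi(a)-j)+t\cdot b,j)$ for $a\in A$, $b\in\varphi(A)$, $j\in C$; and with $\backslash$ the left division with respect to $\ast$ ($x\backslash y$ is the unique $z$ with $x\ast z=y$). In $\mathcal{SIQ}(\mathbb{Z}_{p^\infty},1,C)$ the automorphism $t$ is the identity, so $\varphi=0$. *)

(* Defs.v *)
From HB Require Import structures.
From Stdlib Require List.
From mathcomp Require Import all_boot all_order all_algebra.
From mathcomp Require Import ring.
From mathcomp Require Import boolp classical_sets functions cardinality.

Set Implicit Arguments.
Unset Strict Implicit.
Unset Printing Implicit Defensive.

Import GRing.Theory.

Local Open Scope classical_set_scope.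
Local Open Scope ring_scope.

(* An algebra is given by its carrier and the lists of its unary and binary
   operations. *)

Definition congruence (T : Type) (uops : seq (T -> T))
    (bops : seq (T -> T -> T)) (R : T -> T -> Prop) : Prop :=
  [/\ forall x, R x x,
      forall x y, R x y -> R y x,
      forall x y z, R x y -> R y z -> R x z,
      forall f, List.In f uops -> forall x y, R x y -> R (f x) (f y)
    & forall f, List.In f bops ->
        forall x y u v, R x y -> R u v -> R (f x u) (f y v)].

Definition nontrivial_rel (T : Type) (R : T -> T -> Prop) : Prop :=
  ~ (forall x y, R x y <-> x = y).

Definition subdirectly_irreducible (T : Type) (uops : seq (T -> T))
    (bops : seq (T -> T -> T)) : Prop :=
  nontrivial_rel (fun x y => forall R,
    congruence uops bops R -> nontrivial_rel R -> R x y).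

Record quandle : Type := Quandle {
  qcarrier :> Type;
  qmul : qcarrier -> qcarrier -> qcarrier;
  qldiv : qcarrier -> qcarrier -> qcarrier;
  qmulxx : forall x, qmul x x = x;
  qmulDl : forall x y z, qmul x (qmul y z) = qmul (qmul x y) (qmul x z);
  qmulK : forall x y, qldiv x (qmul x y) = y;
  qldivK : forall x y, qmul x (qldiv x y) = y }.

Declare Scope quandle_scope.
Delimit Scope quandle_scope with quandle.
Notation "x ∗ y" := (qmul x y) (at level 40, left associativity)
  : quandle_scope.
Notation "x ⧵ y" := (qldiv x y) (at level 40, left associativity)
  : quandle_scope.
Local Open Scope quandle_scope.

Definition medial (Q : quandle) : Prop :=
  forall x y u v : Q,
    [/\ (x ∗ y) ∗ (u ∗ v) = (x ∗ u) ∗ (y ∗ v),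
        (x ⧵ y) ⧵ (u ⧵ v) = (x ⧵ u) ⧵ (y ⧵ v)
      & (x ⧵ y) ∗ (u ⧵ v) = (x ∗ u) ⧵ (y ∗ v)].

Definition two_reductive (Q : quandle) : Prop :=
  forall x y : Q, (x ∗ y) ∗ y = y.

Definition quandle_si (Q : quandle) : Prop :=
  subdirectly_irreducible [::] [:: @qmul Q; @qldiv Q].

Definition isomorphic (Q Q' : quandle) : Prop :=
  exists f : Q -> Q', [/\ bijective f,
    {morph f : x y / x ∗ y} & {morph f : x y / x ⧵ y}].

Definition infinite_si_2reductive_medial (Q : quandle) : Prop :=
  [/\ infinite_set [set: Q], quandle_si Q, two_reductive Q & medial Q].

(* The isomorphism classes of the quandles satisfying P.  This is not stated
   with [set quandle]: the type of quandles is too large, as the carriers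
   range over the universe of the types of MathComp structures. *)
Definition iso_classes (P : quandle -> Prop) : Type :=
  {K : quandle -> Prop | exists2 Q, P Q & K = isomorphic Q}.

(* The inverse is part of the data because left division is computed from it.
   Such a record is the same thing as a Z[t, t^-1]-module structure on A. *)
Record zmod_aut (A : zmodType) := ZmodAut {
  autf :> {additive A -> A};
  autV : A -> A;
  autK : cancel autf autV;
  autVK : cancel autV autf }.

Definition id_aut (A : zmodType) : zmod_aut A :=
  @ZmodAut A idfun idfun (fun _ => erefl) (fun _ => erefl).

(* Congruences for +, -, t and t^-1 are exactly the Z[t, t^-1]-module
   congruences of A. *)
Definition module_si (A : zmodType) (t : zmod_aut A) : Prop :=
  subdirectly_irreducible [:: -%R; t : A -> A; autV t] [:: +%R].

Definition generated_subgroup (A : zmodType) (S : set A) : set A :=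
  smallest [set H | H 0 /\ forall x y, H x -> H y -> H (x - y)] S.

Section SIQ.
Variables (A : zmodType) (t : zmod_aut A) (C : set A).

Definition siq_phi (a : A) : A := a - t a.
Local Notation φ := siq_phi.

Definition siq_admissible : Prop :=
  [/\ module_si t, ~ injective φ,
      forall i j, C i -> C j -> range φ (i - j) -> i = j
    & generated_subgroup (C `|` range φ) = [set: A]].

Lemma siq_phiD a b : φ (a + b) = φ a + φ b.
Proof. by rewrite /siq_phi raddfD opprD addrACA. Qed.

Lemma siq_phiB a b : φ (a - b) = φ a - φ b.
Proof. by rewrite /siq_phi raddfB !opprB addrACA [in RHS]addrACA [- t a + _]addrC. Qed.

Lemma autVB a b : autV t (a - b) = autV t a - autV t b.
Proof. by apply: (can_inj (autK t)); rewrite raddfB !autVK. Qed.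

Lemma siq_phit a : t (φ a) = φ (t a).
Proof. by rewrite /siq_phi raddfB. Qed.

Lemma siq_phitV a : autV t (φ a) = φ (autV t a).
Proof. by rewrite /siq_phi autVB autK autVK. Qed.

Lemma siq_mul_range x b : range φ b -> range φ (φ x + t b).
Proof. by move=> [c _ <-]; exists (x + t c); rewrite // siq_phiD siq_phit. Qed.

Lemma siq_ldiv_range x b : range φ b -> range φ (autV t (b - φ x)).
Proof.
by move=> [c _ <-]; exists (autV t (c - x)); rewrite // -siq_phitV siq_phiB.
Qed.

Definition siq_carrier : Type := A + {a : A | range φ a} * {c : A | C c}.

Definition siq_mul (x y : siq_carrier) : siq_carrier :=
  match x, y with
  | inl a, inl b => inl (φ a + t b)
  | inr (a, i), inr (b, j) =>
      inr (exist _ _ (siq_mul_range (sval a + sval i - sval j) (svalP b)), j)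
  | inr (a, i), inl b => inl (sval a + t b + sval i)
  | inl a, inr (b, j) =>
      inr (exist _ _ (siq_mul_range (φ a - sval j) (svalP b)), j)
  end.

(* Obtained by solving x * z = y for z; see siq_mulK and siq_ldivK. *)
Definition siq_ldiv (x y : siq_carrier) : siq_carrier :=
  match x, y with
  | inl a, inl b => inl (autV t (b - φ a))
  | inr (a, i), inr (b, j) =>
      inr (exist _ _ (siq_ldiv_range (sval a + sval i - sval j) (svalP b)), j)
  | inr (a, i), inl b => inl (autV t (b - sval a - sval i))
  | inl a, inr (b, j) =>
      inr (exist _ _ (siq_ldiv_range (φ a - sval j) (svalP b)), j)
  end.

Lemma siq_inr_eq (a b : {a : A | range φ a}) (j : {c : A | C c}) :
  sval a = sval b -> inr (a, j) = inr (b, j) :> siq_carrier.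
Proof.
case: a b => [a Pa] [b Pb] /= eab; rewrite eab in Pa *.
by rewrite (Prop_irrelevance Pa Pb).
Qed.

Lemma siq_mulxx x : siq_mul x x = x.
Proof.
case: x => [a|[a i]] /=; first by rewrite /siq_phi subrK.
by apply: siq_inr_eq => /=; rewrite addrK /siq_phi subrK.
Qed.

(* With r := siq_shift, x * b = r x + t b and x * (b, j) = (φ (r x - j) + t b, j). *)
Let siq_shift (x : siq_carrier) : A :=
  match x with inl a => φ a | inr (a, i) => sval a + sval i end.

Let siq_mulA x b : siq_mul x (inl b) = inl (siq_shift x + t b).
Proof. by case: x => [a|[a i]] //=; rewrite addrAC. Qed.

Let siq_mulC x b j : siq_mul x (inr (b, j)) =
  inr (exist _ _ (siq_mul_range (siq_shift x - sval j) (svalP b)), j).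
Proof. by case: x => [a|[a i]]. Qed.

Let siq_phi_id a : φ a + t a = a. Proof. exact: subrK. Qed.

Let siq_shiftM x y : siq_shift (siq_mul x y) = φ (siq_shift x) + t (siq_shift y).
Proof.
case: y => [b|[b j]]; first by rewrite siq_mulA /= siq_phiD siq_phit.
have E : - φ (sval j) + (t (sval b) + sval j) = t (sval b) + t (sval j).
  by rewrite addrCA -{2}(siq_phi_id (sval j)) addKr.
by rewrite siq_mulC /= siq_phiB (raddfD t) -!addrA E.
Qed.

Lemma siq_mulDl x y z :
  siq_mul x (siq_mul y z) = siq_mul (siq_mul x y) (siq_mul x z).
Proof.
have E r s : r + t s = φ r + t s + t r by rewrite addrAC siq_phi_id.
case: z => [c|[c k]].
  by rewrite !siq_mulA siq_shiftM !(raddfD t) !addrA -E.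
rewrite !siq_mulC; apply: siq_inr_eq => /=.
set r := siq_shift x; set s := siq_shift y; set k' := sval k.
have Ek : φ r + t s - k' = φ (r - k') + t (s - k').
  by rewrite siq_phiB (raddfB t) addrACA -opprD siq_phi_id.
by rewrite siq_shiftM !(raddfD t _ (t _)) !addrA Ek (siq_phiD (φ _))
  -siq_phit -E.
Qed.

Lemma siq_mulK x y : siq_ldiv x (siq_mul x y) = y.
Proof.
case: x y => [a|[a i]] [b|[b j]] /=.
- by rewrite [φ a + _]addrC addrK autK.
- by apply: siq_inr_eq => /=; rewrite [_ + t _]addrC addrK autK.
- by rewrite addrAC addrK addrC addKr autK.
- by apply: siq_inr_eq => /=; rewrite [_ + t _]addrC addrK autK.
Qed.

Lemma siq_ldivK x y : siq_mul x (siq_ldiv x y) = y.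
Proof.
case: x y => [a|[a i]] [b|[b j]] /=.
- by rewrite autVK addrC subrK.
- by apply: siq_inr_eq => /=; rewrite autVK addrC subrK.
- by rewrite autVK -addrA subrK addrC subrK.
- by apply: siq_inr_eq => /=; rewrite autVK addrC subrK.
Qed.

(* The construction yields a quandle for arbitrary A, t and C; the conditions
   imposed on them are kept separate, in siq_admissible. *)
Definition SIQ : quandle := Quandle siq_mulxx siq_mulDl siq_mulK siq_ldivK.

End SIQ.

(* Z[1/p]: the rationals whose denominator is a power of the prime p. *)
Definition pinv_pred (p : nat) : {pred rat} :=
  [pred r | (p.-nat `|denq r|)%N].

Lemma pinv_zmod_closed p : zmod_closed (pinv_pred p).
Proof.
split=> [|x y]; rewrite ?unfold_in //= => px py.
have pxy : (p.-nat (`|denq x| * `|denq y|))%N by rewrite pnatM px.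
apply: pnat_dvd pxy; rewrite -abszM.
have E : numq (x - y) * (denq x * denq y) =
         (numq x * denq y - numq y * denq x) * denq (x - y).
  apply: (@intr_inj rat); rewrite !(rmorphM, rmorphB) /= !numqE; ring.
have := dvdn_mull (absz (numq x * denq y - numq y * denq x)%R)
  (dvdnn (absz (denq (x - y)%R))).
by rewrite -abszM -E abszM Gauss_dvdr // coprime_sym coprime_num_den.
Qed.

HB.instance Definition _ p :=
  GRing.isZmodClosed.Build rat (pinv_pred p) (pinv_zmod_closed p).

Record pinv (p : nat) := Pinv { pinv_val :> rat; _ : pinv_val \in pinv_pred p }.

HB.instance Definition _ p := [isSub for @pinv_val p].
HB.instance Definition _ p := [Choice of pinv p by <:].
HB.instance Definition _ p := [SubChoice_isSubZmodule of pinv p by <:].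

Definition pinv_int (p : nat) : {pred pinv p} :=
  [pred r | pinv_val r \is a Num.int].

Lemma pinv_int_zmod_closed p : zmod_closed (@pinv_int p).
Proof.
have E z : (z \in @pinv_int p) = (val z \is a Num.int) by [].
split=> [|x y]; rewrite !E ?raddf0 ?rpred0 // => px py.
by rewrite raddfB rpredB.
Qed.

HB.instance Definition _ p :=
  GRing.isZmodClosed.Build (pinv p) (@pinv_int p) (@pinv_int_zmod_closed p).

(* The Prüfer group, as Z[1/p] / Z. *)
Definition prufer (p : nat) : zmodType := Quotient.quot (@pinv_int p).

(* Main.v *)
(* In a 2-reductive medial quandle Q the left translations L_x commute and are
   constant on the orbits of the abelian group G which they generate.  If Q is
   subdirectly irreducible, collapsing an orbit, or two fixed points with the
   same left translation, gives congruences forcing all but one orbit to be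
   singletons and x |-> L_x to be injective on the set of fixed points.  On the
   remaining orbit G acts regularly, and every subgroup of G induces a
   congruence, so G is a subdirectly irreducible group.  It is infinite, hence a
   Prüfer group, and Q = SIQ(G, 1, C) with C the set of the translations by
   fixed points; C is infinite because it generates G.
   There are at most continuum many pairs (p, C).  Conversely, whether a
   translation of order 2 ^ k.+1 occurs in Q depends only on the isomorphism
   class of Q and can be prescribed freely for odd k, which distinguishes
   continuum many quandles with p = 2. *)
From HB Require Import structures.
Require Import Defs.
From mathcomp Require Import all_boot all_order all_algebra.
From mathcomp Require Import generic_quotient ring_quotient zify.
From mathcomp Require Import boolp classical_sets functions cardinality.

Set Implicit Arguments.
Unset Strict Implicit.
Unset Printing Implicit Defensive.

Import Order.TTheory GRing.Theory Num.Theory.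

Local Open Scope classical_set_scope.
Local Open Scope quotient_scope.
Local Open Scope ring_scope.
Local Open Scope quandle_scope.

(** * Prüfer groups *)

Definition multiple_of (A : zmodType) (c x : A) : Prop := exists n : int, x = c *~ n.

Lemma multiple_of_trans (A : zmodType) (a b c : A) :
  multiple_of a b -> multiple_of b c -> multiple_of a c.
Proof. by move=> [n ->] [m ->]; exists (n * m); rewrite mulrzA. Qed.

Lemma multiple_of_coprime (A : zmodType) (x : A) (N : nat) (n : int) :
  x *+ N = 0 -> coprimez N n -> multiple_of (x *~ n) x.
Proof.
move=> xN /coprimezP [[u v] /= E]; exists v.
by rewrite -[LHS]mulr1z -E mulrzDr [u * _]mulrC !mulrzA -pmulrn xN mul0rz add0r mulrzAC.
Qed.

Lemma finite_multiples (A : zmodType) (x : A) (N : nat) :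
  (0 < N)%N -> x *+ N = 0 -> finite_set [set y | multiple_of x y].
Proof.
move=> N0 xN; apply: (sub_finite_set (B := (fun i => x *+ i) @` `I_N)); last first.
  exact/finite_image/finite_II.
have N0' : Posz N != 0 by rewrite eqz_nat -lt0n.
move=> _ [n ->]; exists `|(n %% N)%Z|%N.
  by rewrite /= -ltz_nat gez0_abs ?modz_ge0 // ltz_pmod.
rewrite pmulrn gez0_abs ?modz_ge0 //.
rewrite [RHS](_ : _ = x *~ ((n %/ N)%Z * N) + x *~ (n %% N)%Z).
  by rewrite mulrzA mulrzAC -pmulrn xN mul0rz add0r.
by rewrite -mulrzDr -divz_eq.
Qed.

Lemma dvdz_prime_order (A : zmodType) (p : nat) (x : A) (n : int) :
  prime p -> x != 0 -> x *+ p = 0 -> x *~ n = 0 -> (p %| n)%Z.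
Proof.
move=> pp x0 xp xn; apply: contraNT x0 => pn.
have [|m ->] := multiple_of_coprime (n := n) xp; last by rewrite xn mul0rz.
by rewrite coprimezE prime_coprime.
Qed.

(** [s k] plays the role of the class of 1/p^k in Z[1/p]/Z. For [p] prime, such a sequence
    determines the group up to isomorphism, so Prüfer groups are recognised through it. *)
Record prufer_seq (A : zmodType) (p : nat) (s : nat -> A) : Prop := PruferSeq {
  prufer_seq0 : s 0%N = 0;
  prufer_seqS : forall k, s k.+1 *+ p = s k;
  prufer_seq1 : s 1%N != 0;
  prufer_seq_gen : forall x, exists k, multiple_of (s k) x }.

Section PruferSeq.
Variables (A : zmodType) (p : nat) (s : nat -> A).
Hypotheses (p_prime : prime p) (sP : prufer_seq p s).

Lemma prufer_seqD k l : s (k + l)%N *+ p ^ l = s k.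
Proof.
elim: l => [|l IHl]; first by rewrite addn0 expn0 mulr1n.
by rewrite addnS expnS mulrnA (prufer_seqS sP) IHl.
Qed.

Lemma prufer_seq_tors k : s k *+ p ^ k = 0.
Proof. by rewrite -{1}[k]add0n prufer_seqD (prufer_seq0 sP). Qed.

Lemma prufer_seq_top k : s k.+1 *+ p ^ k != 0.
Proof. by rewrite -[k.+1]add1n prufer_seqD; exact: prufer_seq1 sP. Qed.

(** Multiplying [s k.+1 *~ n = 0] by [p] gives n = m p^k by induction; then [s 1 *~ m = 0], and
    [s 1] has order [p]. *)
Lemma prufer_seq_eq0 k n : s k *~ n = 0 <-> ((p ^ k)%N %| n)%Z.
Proof.
split=> [|/dvdzP[m ->]]; last first.
  by rewrite mulrzA mulrzAC -pmulrn prufer_seq_tors mul0rz.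
elim: k n => [|k IHk] n; first by rewrite expn0 dvd1z.
move=> E; have /IHk /dvdzP[m Em] : s k *~ n = 0.
  by rewrite -(prufer_seqS sP) pmulrn mulrzAC E mul0rz.
have : s 1%N *~ m = 0.
  by rewrite -(prufer_seqD 1 k) add1n pmulrn mulrzAC -mulrzA -Em.
move/(dvdz_prime_order p_prime (prufer_seq1 sP)).
rewrite (prufer_seqS sP) (prufer_seq0 sP) => /(_ erefl) pm.
by rewrite Em expnS PoszM dvdz_mul.
Qed.

(** Both sides are multiples of [s (k + l)]. The criterion is pure integer arithmetic, so it can be
    transported between groups. *)
Lemma prufer_seq_eq k l n m :
  s k *~ n = s l *~ m <-> ((p ^ (k + l))%N %| n * (p ^ l)%N - m * (p ^ k)%N)%Z.
Proof.
rewrite -(prufer_seq_eq0 (k + l)) mulrzBr ![_ * Posz (p ^ _)%N]mulrC !mulrzA.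
rewrite -!pmulrn prufer_seqD [(k + l)%N]addnC prufer_seqD.
by split=> [->|/eqP]; rewrite ?subrr // subr_eq0 => /eqP.
Qed.

Lemma prufer_seqDmul k l n m :
  s k *~ n + s l *~ m = s (k + l)%N *~ (n * (p ^ l)%N + m * (p ^ k)%N).
Proof.
rewrite mulrzDr ![_ * Posz (p ^ _)%N]mulrC !mulrzA -!pmulrn prufer_seqD.
by rewrite [(k + l)%N]addnC prufer_seqD.
Qed.

(** Write [c] as a multiple of some [s j] and cancel factors [p] of the coefficient against [j].
    Once the coefficient is prime to [p], Bézout recovers [s j] from [c], and j > k because p^k does
    not kill [c]. *)
Lemma prufer_seq_multiple k (c : A) : c *+ p ^ k != 0 -> multiple_of c (s k.+1).
Proof.
have [j [n ->]] := prufer_seq_gen sP c.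
elim: j n => [|j IHj] n; first by rewrite (prufer_seq0 sP) mul0rz mul0rn eqxx.
have [/dvdzP[m ->]|pn] := boolP (p %| n)%Z.
  by rewrite mulrzA mulrzAC -pmulrn (prufer_seqS sP); apply: IHj.
move=> kj; have ltkj : (k < j.+1)%N.
  rewrite ltnNge; apply: contra kj => lejk.
  rewrite -(subnKC lejk) expnD mulrnA pmulrn pmulrn.
  by rewrite [s _ *~ _ *~ _]mulrzAC -[s _ *~ _]pmulrn prufer_seq_tors !mul0rz.
apply: (@multiple_of_trans _ _ (s j.+1)); last first.
  exists (Posz (p ^ (j - k)))%N.
  by rewrite -pmulrn -(prufer_seqD k.+1 (j - k)) addSn subnKC.
apply: (multiple_of_coprime (prufer_seq_tors _)).
by rewrite coprimezE /= coprime_pexpl // prime_coprime.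
Qed.

Lemma prufer_seq_killed (x : A) : exists k, x *+ p ^ k = 0.
Proof.
have [k [n ->]] := prufer_seq_gen sP x; exists k.
by rewrite pmulrn mulrzAC -pmulrn prufer_seq_tors mul0rz.
Qed.

Lemma prufer_seq_layer k (x : A) : x *+ p ^ k = 0 -> multiple_of (s k) x.
Proof.
have [j [n ->]] := prufer_seq_gen sP x => /eqP.
rewrite pmulrn -mulrzA => /eqP /prufer_seq_eq0 jn.
have [lejk|/ltnW lekj] := leqP j k.
  exists (Posz (p ^ (k - j))%N * n); rewrite mulrzA -pmulrn.
  by rewrite -(prufer_seqD j (k - j)) subnKC.
move: jn; rewrite -(subnK lekj) expnD PoszM dvdz_mul2r; last first.
  by rewrite eqz_nat -lt0n expn_gt0 prime_gt0.
case/dvdzP => m ->; exists m.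
by rewrite mulrzA mulrzAC -pmulrn addnC prufer_seqD.
Qed.

Lemma finite_prufer_layer k : finite_set [set x : A | x *+ p ^ k = 0].
Proof.
apply: sub_finite_set (finite_multiples _ (prufer_seq_tors k)).
  exact: prufer_seq_layer.
by rewrite expn_gt0 prime_gt0.
Qed.

Lemma infinite_prufer_unkilled (C : set A) k :
  infinite_set C -> exists2 c, C c & c *+ p ^ k != 0.
Proof.
move=> infC; apply: contrapT => noc; apply: infC.
apply: sub_finite_set (finite_prufer_layer k) => c Cc /=.
by apply: contrapT => ck; apply: noc; exists c => //; apply/eqP.
Qed.

Lemma finite_prufer_killed (C : set A) :
  finite_set C -> exists k, forall c, C c -> c *+ p ^ k = 0.
Proof.
move=> /finite_seqP [r ->]; elim: r => [|c r [k IHr]]; first by exists 0%N.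
have [l cl] := prufer_seq_killed c; exists (k + l)%N => x /=.
rewrite inE => /predU1P[->|/IHr xk]; last by rewrite expnD mulrnA xk mul0rn.
by rewrite addnC expnD mulrnA cl mul0rn.
Qed.

End PruferSeq.

(** Sending [s k *~ n] to [r k *~ n] is well defined both ways, because equality of multiples obeys
    the same divisibility criterion in both groups. *)
Lemma prufer_seq_iso (A B : zmodType) (p : nat) (s : nat -> A) (r : nat -> B) :
  prime p -> prufer_seq p s -> prufer_seq p r ->
  exists f : A -> B, bijective f /\ {morph f : x y / x + y}.
Proof.
move=> pp sP rP.
have transfer (A' B' : zmodType) (s' : nat -> A') (r' : nat -> B') :
    prufer_seq p s' -> prufer_seq p r' -> exists f : A' -> B',
    forall k n, f (s' k *~ n) = r' k *~ n.
  move=> s'P r'P.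
  have /choice[f fP] (x : A') :
      exists y, forall k n, x = s' k *~ n -> y = r' k *~ n.
    have [k [n ->]] := prufer_seq_gen s'P x.
    exists (r' k *~ n) => l m.
    by rewrite (prufer_seq_eq pp s'P) (prufer_seq_eq pp r'P).
  by exists f => k n; exact: fP.
have [f fP] := transfer _ _ _ _ sP rP; have [g gP] := transfer _ _ _ _ rP sP.
exists f; split.
  exists g => [x|y].
    by have [k [n ->]] := prufer_seq_gen sP x; rewrite fP gP.
  by have [k [n ->]] := prufer_seq_gen rP y; rewrite gP fP.
move=> x y; have [k [n ->]] := prufer_seq_gen sP x.
have [l [m ->]] := prufer_seq_gen sP y.
by rewrite (prufer_seqDmul sP) !fP (prufer_seqDmul rP).
Qed.

(** * Infinite subdirectly irreducible abelian groups *)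

Section SIGroup.
Variables (A : zmodType) (m : A).
Hypotheses (m_neq0 : m != 0)
  (m_min : forall x : A, x != 0 -> multiple_of x m).

(** Unless 2m = 0, m = 2nm for some n, so [m] is killed by 2n - 1, which is odd and hence non-zero.
    Every non-zero [x] has [m] as a multiple, with a non-zero coefficient, and so is torsion too. *)
Lemma si_torsion (x : A) : exists2 N, (0 < N)%N & x *+ N = 0.
Proof.
have abs (y : A) n : n != 0 -> y *~ n = 0 -> exists2 N, (0 < N)%N & y *+ N = 0.
  case: n => [k|k] n0 yn; first by exists k; rewrite ?lt0n // pmulrn.
  by exists k.+1 => //; apply: oppr_inj; rewrite oppr0 -[RHS]yn.
have [N N0 mN] : exists2 N, (0 < N)%N & m *+ N = 0.
  have [m2|/m_min[n mn]] := eqVneq (m *+ 2) 0; first by exists 2.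
  apply: (abs _ (2 * n - 1)).
    by apply/eqP; lia.
  by rewrite mulrzBr mulrzA -[m *~ 2]pmulrn -mn mulr1z subrr.
have [->|/m_min[n mn]] := eqVneq x 0; first by exists 1%N.
apply: (abs _ (n * N)); last by rewrite mulrzA -mn -pmulrn.
rewrite mulf_neq0 //; last by case: N N0 {mN}.
by apply: contraNneq m_neq0 => n0; rewrite mn n0.
Qed.

(** With N the order of [m] and q a prime factor of N, the element m(N/q) is non-zero and killed by
    q; [m] is a multiple of it. *)
Lemma si_prime : exists2 p, prime p & m *+ p = 0.
Proof.
have exN : exists N, (0 < N)%N && (m *+ N == 0).
  by have [N N0 /eqP mN] := si_torsion m; exists N; rewrite N0.
case: (ex_minnP exN) => N /andP[N0 /eqP mN] minN.
have N1 : (1 < N)%N.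
  rewrite ltn_neqAle N0 andbT; apply: contraNneq m_neq0 => N1.
  by rewrite -N1 in mN; rewrite -mN.
have pp := pdiv_prime N1; exists (pdiv N) => //.
have /m_min[n mn] : m *+ (N %/ pdiv N) != 0.
  apply/negP => /eqP E.
  have := minN (N %/ pdiv N)%N; rewrite E eqxx andbT divn_gt0 ?pdiv_gt0 //.
  rewrite dvdn_leq ?pdiv_dvd // => /(_ isT).
  by rewrite leqNgt ltn_Pdiv // prime_gt1.
by rewrite {1}mn pmulrn mulrzAC -pmulrn -mulrnA divnK ?pdiv_dvd // mN mul0rz.
Qed.

Variable p : nat.
Hypotheses (p_prime : prime p) (mp : m *+ p = 0).

(** If the [p]-part of N did not kill [x], [m] would be a multiple of the resulting element, hence
    killed by a number prime to [p]. *)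
Lemma si_killed (x : A) : exists k, x *+ p ^ k = 0.
Proof.
have [N N0 xN] := si_torsion x.
have [b pb EN] := pfactor_coprime p_prime N0.
exists (logn p N); apply/eqP; apply: contraLR pb => /m_min[n mn].
rewrite prime_coprime // negbK -(dvdzE p b).
apply: (dvdz_prime_order p_prime m_neq0 mp).
by rewrite mn mulrzAC -pmulrn -mulrnA mulnC -EN xN mul0rz.
Qed.

(** By induction py = n(px) for some n. Then y - nx is killed by [p], hence a multiple of [m], which
    is itself a multiple of [x]. *)
Lemma si_layer k (x y : A) :
  x *+ p ^ k != 0 -> y *+ p ^ k.+1 = 0 -> multiple_of x y.
Proof.
have socle z : z *+ p = 0 -> multiple_of m z.
  move=> zp; have [->|/m_min[n mn]] := eqVneq z 0; first by exists 0.
  have pn : ~~ (p %| n)%Z.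
    apply: contra m_neq0 => /dvdzP[n' En].
    by rewrite mn En mulrzA mulrzAC -pmulrn zp mul0rz.
  rewrite mn; apply: (multiple_of_coprime zp).
  by rewrite coprimezE prime_coprime.
elim: k x y => [|k IHk] x y xk yk.
  apply: multiple_of_trans (m_min _) (socle y _); first by rewrite -(mulr1n x).
  by rewrite -yk expn1.
have [n yn] : multiple_of (x *+ p) (y *+ p).
  by apply: IHk; rewrite -mulrnA -expnS.
have /socle : (y - x *~ n) *+ p = 0.
  by rewrite mulrnBl yn [x *+ p]pmulrn mulrzAC -pmulrn subrr.
have x0 : x != 0 by apply: contraNneq xk => ->; rewrite mul0rn.
move=> /(multiple_of_trans (m_min x0)) [l E].
by exists (l + n); rewrite mulrzDr -E subrK.
Qed.

Hypothesis infA : infinite_set [set: A].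

(** If p^(k+1) kills the group but p^k does not, [si_layer] makes the group cyclic and finite. *)
Lemma si_unkilled k : exists x : A, x *+ p ^ k != 0.
Proof.
apply: contrapT => nok.
have {nok} : forall x : A, x *+ p ^ k = 0.
  by move=> x; apply/eqP; apply: contrapT => xk; apply: nok; exists x; apply/negP.
elim: k => [|k IHk] killed.
  by move: m_neq0; rewrite -(mulr1n m) -(expn0 p) killed eqxx.
apply: contrapT => _; apply: infA.
have [x xk] : exists x : A, x *+ p ^ k != 0.
  apply: contrapT => nok; apply: IHk => x; apply/eqP.
  by apply: contrapT => xk; apply: nok; exists x; apply/negP.
apply: sub_finite_set (finite_multiples _ (killed x)).
  by move=> y _; exact: si_layer xk (killed y).
by rewrite expn_gt0 prime_gt0.
Qed.

Lemma si_divisible (x : A) : exists y : A, y *+ p = x.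
Proof.
have [k xk] := si_killed x; have [z zk] := si_unkilled k.+1.
have [||n ->] := @si_layer k (z *+ p) x; first by rewrite -mulrnA -expnS.
  by rewrite expnSr mulrnA xk mul0rn.
by exists (z *~ n); rewrite pmulrn mulrzAC -pmulrn.
Qed.

Lemma si_prufer_seq : exists s : nat -> A, prufer_seq p s.
Proof.
have /choice[g gP] := si_divisible.
(* Divide [m] by [p] repeatedly; the index is shifted so that [s 1 = m]. *)
exists (fun k => if k is k'.+1 then iter k' g m else 0).
have mk k : iter k g m *+ p ^ k = m.
  elim: k => [|k IHk]; first by rewrite mulr1n.
  by rewrite expnS mulrnA iterS gP.
split=> // [[|k]|x]; rewrite /= ?mulr1n ?gP //.
have [k xk] := si_killed x; exists k.+1; apply: (@si_layer k); rewrite /= ?mk //.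
by rewrite expnSr mulrnA xk mul0rn.
Qed.

End SIGroup.

(** The classes of 1/p^k work: 1/p is not an integer, and a fraction with reduced denominator p^k is
    its numerator times 1/p^k. *)
Lemma prufer_prufer_seq (p : nat) :
  prime p -> exists s : nat -> prufer p, prufer_seq p s.
Proof.
move=> pp; have p0 : (p%:R : rat) != 0 by rewrite pnatr_eq0 -lt0n prime_gt0.
have dk k : denq ((p ^ k)%N%:R^-1 : rat) = (p ^ k)%N.
  have pk0 : (p ^ k)%N != 0%N by rewrite -lt0n expn_gt0 prime_gt0.
  have := @coprimeq_den 1 (p ^ k)%N; rewrite coprime1n => /(_ isT).
  by rewrite div1r eqz_nat (negPf pk0) => ->.
have inv_in k : (p ^ k)%N%:R^-1 \in pinv_pred p.
  by rewrite inE dk /= pnatX pnat_id.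
pose t k := Pinv (inv_in k); pose Zp := Quotient.quot (@pinv_int p).
pose pi (r : Defs.pinv p) : prufer p := \pi_Zp r.
have piD r r' : pi (r + r') = pi r + pi r' by rewrite /pi !piE.
have piM r n : pi (r *~ n) = pi r *~ n.
  exact: (raddfMz (\pi_Zp : {additive Defs.pinv p -> Zp})).
have pi0 r : pi r = 0 <-> val r \is a Num.int.
  have -> : pi r = 0 <-> (r - 0 \in @pinv_int p).
    rewrite Quotient.idealrBE; split=> [E|/eqP E].
      by apply/eqP; rewrite -/(pi r) E piE.
    by rewrite /pi E piE.
  by rewrite subr0.
exists (pi \o t); split=> /= [|k||x].
- by apply/pi0; rewrite /= expn0 invr1 rpred1.
- rewrite pmulrn -piM; congr pi; apply: val_inj.
  rewrite raddfMz /= -mulrzr expnS natrM invfM mulrC mulrA mulfV ?mul1r //.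
- apply/eqP => /pi0; rewrite /= expn1 => /intrP[m Em].
  have : (p %| 1)%Z.
    apply/dvdzP; exists m; apply: (@intr_inj rat).
    by rewrite rmorphM /= -Em mulVf.
  by rewrite dvdz1 /= => /eqP p1; rewrite p1 in pp.
- rewrite -[x]reprK; set r := repr x.
  have /p_natP[k Ek] : p.-nat `|denq (val r)|%N by exact: (valP r).
  exists k, (numq (val r)); rewrite -piM; congr pi; apply: val_inj.
  rewrite raddfMz /= -mulrzr mulrC -[LHS]divq_num_den; congr (_ / _).
  by rewrite -(gez0_abs (denq_ge0 _)) Ek.
Qed.

(** * Congruences *)

Lemma nontrivial_relP (T : Type) (R : T -> T -> Prop) :
  (forall x, R x x) -> nontrivial_rel R <-> exists x y, x <> y /\ R x y.
Proof.
move=> refl; split=> [ntR|[x [y [xy Rxy]]] E]; last exact/xy/E.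
apply: contrapT => noxy; apply: ntR => x y; split=> [Rxy|->//].
by apply: contrapT => xy; apply: noxy; exists x, y.
Qed.

(** Replaces the intersection of congruences by one distinguished pair that every non-trivial
    congruence must identify. *)
Lemma subdirectly_irreducibleP (T : Type) (uops : seq (T -> T))
    (bops : seq (T -> T -> T)) :
  subdirectly_irreducible uops bops <->
  exists u v, u <> v /\ forall R, congruence uops bops R ->
    (exists x y, x <> y /\ R x y) -> R u v.
Proof.
rewrite /subdirectly_irreducible nontrivial_relP; last by move=> x R [].
split=> -[u [v [uv mono]]]; exists u, v; split=> // R congR.
  by move=> ntR; apply: mono => //; apply/nontrivial_relP => //; case: congR.
by move/nontrivial_relP => ntR; apply: mono => //; apply: ntR; case: congR.
Qed.

Lemma congruence_multiples (A : zmodType) (R : A -> A -> Prop) (x y : A) (n : int) :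
  congruence [:: -%R] [:: +%R] R -> R x y -> R ((x - y) *~ n) 0.
Proof.
move=> [refl sym trans congN congD] Rxy.
have RN a b : R a b -> R (- a) (- b) by apply: congN; left.
have RD a b c d : R a b -> R c d -> R (a + c) (b + d) by apply: congD; left.
have Rc : R (x - y) 0 by rewrite -(subrr y); exact: RD.
have Rn k : R ((x - y) *+ k) 0.
  by elim: k => [|k IHk] //; rewrite mulrS -[0]addr0; exact: RD.
by case: n => k; [exact: Rn | rewrite -oppr0; apply/RN/Rn].
Qed.

Lemma range_siq_phi_id (A : zmodType) : range (siq_phi (id_aut A)) = [set 0].
Proof.
apply/seteqP; split=> [_ [a _ <-]|_ ->]; first by rewrite /siq_phi subrr.
by exists 0; rewrite // /siq_phi subrr.
Qed.

(** * Admissibility of Prüfer groups *)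

Section PruferAdmissible.
Variables (p : nat) (s : nat -> prufer p).
Hypotheses (p_prime : prime p) (sP : prufer_seq p s).

Lemma prufer_module_si : module_si (id_aut (prufer p)).
Proof.
apply/subdirectly_irreducibleP; exists (s 1%N), 0; split.
  exact/eqP/(prufer_seq1 sP).
move=> R [refl sym trans congN congD] [x [y [xy Rxy]]].
have [|n ->] := @prufer_seq_multiple _ _ _ p_prime sP 0 (x - y).
  by rewrite mulr1n subr_eq0; exact/eqP.
apply: congruence_multiples => //.
by split=> // f [<-|[]]; exact: congN (or_introl erefl).
Qed.

(** If p^k kills [x], some element of [C] is not killed by p^k, since that layer is finite; its
    multiples contain the whole layer. *)
Lemma infinite_subset_generates (C : set (prufer p)) :
  infinite_set C -> generated_subgroup C = [set: prufer p].
Proof.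
move=> infC; apply/seteqP; split=> // x _ H [[H0 HB] CH].
have [k /(prufer_seq_layer p_prime sP) [n xn]] := prufer_seq_killed sP x.
have [c Cc ck] := infinite_prufer_unkilled p_prime sP k infC.
have [l cl] := prufer_seq_multiple p_prime sP ck.
have HN a : H a -> H (- a) by move=> Ha; rewrite -sub0r; exact: HB.
have HM a j : H a -> H (a *~ j).
  move=> Ha; have HMn i : H (a *+ i).
    by elim: i => [|i IHi] //; rewrite mulrSr -[a in _ + a]opprK; apply/HB/HN.
  by case: j => i; [exact: HMn | exact/HN/HMn].
rewrite xn -(prufer_seqS sP) cl pmulrn; apply/HM/HM/HM; exact: CH.
Qed.

Lemma prufer_admissible (C : set (prufer p)) :
  infinite_set C -> siq_admissible (id_aut (prufer p)) C.
Proof.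
move=> infC; rewrite /siq_admissible range_siq_phi_id; split.
- exact: prufer_module_si.
- move=> inj; apply/negP: (prufer_seq1 sP); rewrite negbK; apply/eqP/inj.
  by rewrite /siq_phi !subrr.
- by move=> i j _ _ /eqP; rewrite subr_eq0 => /eqP.
- apply: infinite_subset_generates; apply: sub_infinite_set infC => x; exact: or_introl.
Qed.

End PruferAdmissible.

(** * 2-reductive medial quandles and their translation groups *)

Definition commuting_translations (Q : quandle) : Prop :=
  (forall x y z : Q, (x ∗ y) ∗ z = y ∗ z) /\
  (forall x y z : Q, x ∗ (y ∗ z) = y ∗ (x ∗ z)).

Lemma qmulI (Q : quandle) (x : Q) : injective (qmul x).
Proof. exact: (can_inj (qmulK x)). Qed.

Lemma qldivxx (Q : quandle) (x : Q) : x ⧵ x = x.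
Proof. by rewrite -{2}(qmulxx x) qmulK. Qed.

(* The displacement maps [L_a L_b^-1] commute in a medial quandle. *)
Lemma medial_displacement (Q : quandle) : medial Q ->
  forall a b c d v : Q, a ∗ (b ⧵ (c ∗ (d ⧵ v))) = c ∗ (d ⧵ (a ∗ (b ⧵ v))).
Proof.
move=> medQ.
have swap (x y u v : Q) : y ∗ (x ⧵ (u ∗ v)) = u ∗ (x ⧵ (y ∗ v)).
  by apply: (@qmulI Q x); rewrite !(qmulDl x) !qldivK; case: (medQ x y u v).
move=> a b c d v; rewrite swap; congr (_ ∗ _).
by apply: (@qmulI Q b); rewrite qldivK -[in LHS](qldivK b v) swap.
Qed.

Lemma two_reductive_medialP (Q : quandle) :
  two_reductive Q /\ medial Q <-> commuting_translations Q.
Proof.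
split=> [[redQ medQ]|[mulM mulCA]].
  have comm := medial_displacement medQ.
  (* L_z fixes [z] and [y ⧵ z]. Commuting the displacements L_(z∗y) L_z^-1 and L_z L_y^-1 at [z]
     then gives the claim. *)
  have orbit_fix (y z : Q) : z ∗ (y ∗ z) = y ∗ z.
    have zv : z ∗ (y ⧵ z) = y ⧵ z by rewrite -{1}(qldivK y z) redQ.
    have := comm (z ∗ y) z z y z; rewrite qmulK -{1}zv -qmulDl qldivK qldivxx.
    rewrite -{5}(qmulxx z) -qmulDl => /(@qmulI Q z) E.
    by rewrite [in RHS]E qldivK.
  (* Writing z = z∗z, mediality gives (x∗z)∗(y∗z); commuting L_(x∗z) L_z^-1 with L_y L_z^-1 at [z]
     turns it into y∗z. *)
  have mulM (x y z : Q) : (x ∗ y) ∗ z = y ∗ z.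
    rewrite -{1}(qmulxx z); have [-> _ _] := medQ x y z z.
    have := comm (x ∗ z) z y z z.
    by rewrite qldivxx -{1}(orbit_fix y z) qmulK redQ qldivxx.
  by split=> // x y z; rewrite qmulDl mulM.
(* For the converse, the first law is extended to [⧵]; the medial identities then reduce to
   commuting translations. *)
have ldivM (x y z : Q) : (x ⧵ y) ∗ z = y ∗ z by rewrite -[in RHS](qldivK x y) mulM.
have mulV (x y z : Q) : (x ∗ y) ⧵ z = y ⧵ z.
  by apply: (@qmulI Q y); rewrite -[LHS](mulM x) !qldivK.
have ldivV (x y z : Q) : (x ⧵ y) ⧵ z = y ⧵ z.
  by apply: (@qmulI Q y); rewrite -[LHS](ldivM x) !qldivK.
split=> [x y|x y z t]; first by rewrite mulM qmulxx.
split; first by rewrite !mulM mulCA.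
  rewrite !ldivV; apply: (@qmulI Q y); apply: (@qmulI Q z).
  by rewrite qldivK mulCA !qldivK.
by rewrite ldivM mulV; apply: (@qmulI Q z); rewrite qldivK mulCA qldivK.
Qed.

(** * The group generated by the left translations *)

Section TranslationGroup.
Variables (Q : quandle) (HQ : commuting_translations Q).

Inductive translation : (Q -> Q) -> Prop :=
| translation_id : translation idfun
| translation_mul x g : translation g -> translation (fun y => x ∗ g y)
| translation_ldiv x g : translation g -> translation (fun y => x ⧵ g y).

Implicit Types g h : Q -> Q.

Lemma qmulM (x y z : Q) : (x ∗ y) ∗ z = y ∗ z. Proof. exact: HQ.1. Qed.

Lemma qmulCA (x y z : Q) : x ∗ (y ∗ z) = y ∗ (x ∗ z). Proof. exact: HQ.2. Qed.

Lemma qldivM (x y z : Q) : (x ⧵ y) ∗ z = y ∗ z.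
Proof. by rewrite -[in RHS](qldivK x y) qmulM. Qed.

Lemma translationM g x y : translation g -> g (x ∗ y) = x ∗ g y.
Proof.
elim=> [//|z h _ IHh|z h _ IHh]; first by rewrite IHh qmulCA.
by apply: (@qmulI Q z); rewrite qldivK qmulCA qldivK IHh.
Qed.

Lemma translationV g x y : translation g -> g (x ⧵ y) = x ⧵ g y.
Proof. by move=> tg; apply: (@qmulI Q x); rewrite -translationM // !qldivK. Qed.

Lemma mul_translation g x y : translation g -> g x ∗ y = x ∗ y.
Proof. by elim=> [//|z h _ IHh|z h _ IHh]; rewrite ?qmulM ?qldivM IHh. Qed.

Lemma translation_comp g h : translation g -> translation h -> translation (g \o h).
Proof.
move=> tg th; elim: tg => [//|x k _|x k _]; first exact: translation_mul.
exact: translation_ldiv.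
Qed.

Lemma translation_comm g h x : translation g -> translation h -> g (h x) = h (g x).
Proof.
by move=> tg; elim=> [//|y k _ IHk|y k _ IHk]; rewrite ?translationM ?translationV ?IHk.
Qed.

Lemma translation_inv g :
  translation g -> exists2 h, translation h & cancel h g.
Proof.
elim=> [|x k tk [h th hK]|x k tk [h th hK]].
- by exists idfun; first exact: translation_id.
- exists (fun y => x ⧵ h y); first exact: translation_ldiv.
  by move=> y; rewrite translationV // hK qldivK.
- exists (fun y => x ∗ h y); first exact: translation_mul.
  by move=> y; rewrite translationM // hK qmulK.
Qed.

(* The unused argument is what the group structure is inferred from. *)
Definition translation_group of commuting_translations Q : Type :=
  {g : Q -> Q | translation g}.
Local Notation G := (translation_group HQ).

HB.instance Definition _ := gen_eqMixin G.
HB.instance Definition _ := gen_choiceMixin G.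

Definition tr_add (g h : G) : G :=
  exist _ _ (translation_comp (svalP g) (svalP h)).
Definition tr_zero : G := exist _ _ translation_id.
Definition tr_opp (g : G) : G :=
  let ig := cid2 (translation_inv (svalP g)) in exist _ (s2val ig) (s2valP ig).

Lemma tr_eq (g h : G) : sval g =1 sval h -> g = h.
Proof. by case: g h => [g tg] [h th] /funext E; exact: eq_exist. Qed.

Fact tr_addA : associative tr_add. Proof. by move=> g h k; apply: tr_eq. Qed.
Fact tr_addC : commutative tr_add.
Proof. by move=> g h; apply: tr_eq => x /=; apply: translation_comm; exact: svalP. Qed.
Fact tr_add0 : left_id tr_zero tr_add. Proof. by move=> g; apply: tr_eq. Qed.
Fact tr_addN : left_inverse tr_zero tr_opp tr_add.
Proof.
move=> g; rewrite tr_addC; apply: tr_eq => x /=.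
by rewrite /tr_opp; case: cid2 => h /= _ ->.
Qed.

HB.instance Definition _ :=
  GRing.isZmodule.Build G tr_addA tr_addC tr_add0 tr_addN.

Definition left_translation (x : Q) : G :=
  exist _ _ (translation_mul x translation_id).

(** Related elements have the same left translation, so only compatibility in the right argument
    remains to be checked. *)
Lemma congruence_of_kernel (R : Q -> Q -> Prop) :
  (forall x, R x x) -> (forall x y, R x y -> R y x) ->
  (forall x y z, R x y -> R y z -> R x z) ->
  (forall x y z, R x y -> x ∗ z = y ∗ z) ->
  (forall x y z, R x y -> R (z ∗ x) (z ∗ y)) ->
  (forall x y z, R x y -> R (z ⧵ x) (z ⧵ y)) ->
  congruence [::] [:: @qmul Q; @qldiv Q] R.
Proof.
move=> refl sym trans ker mulR ldivR.
split=> // f [<-|[<-|[]]] x y u v Rxy Ruv; first by rewrite (ker _ _ _ Rxy); exact: mulR.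
rewrite (_ : x ⧵ u = y ⧵ u); first exact: ldivR.
by apply: (@qmulI Q y); rewrite -[LHS](ker _ _ _ Rxy) !qldivK.
Qed.

End TranslationGroup.

(** * Infinite subdirectly irreducible quandles *)

Section SIStructure.
Variables (Q : quandle) (HQ : commuting_translations Q) (u v : Q).
Hypotheses (uv : u <> v)
  (mono : forall R, congruence [::] [:: @qmul Q; @qldiv Q] R ->
    (exists x y, x <> y /\ R x y) -> R u v).
Hypothesis infQ : infinite_set [set: Q].

Local Notation G := (translation_group HQ).

Definition fixed (x : Q) : Prop := forall y : Q, y ∗ x = x.

Definition same_orbit (x y : Q) : Prop := exists g : G, y = sval g x.

Lemma same_orbit_sym x y : same_orbit x y -> same_orbit y x.
Proof.
move=> [g ->]; have [h th hK] := translation_inv HQ (svalP g).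
exists (exist _ h th : G) => /=.
by rewrite (translation_comm HQ _ th (svalP g)) hK.
Qed.

Lemma same_orbit_qmul x y z : same_orbit x y -> same_orbit x (z ∗ y).
Proof. by move=> [g ->]; exists (left_translation HQ z + g). Qed.

Lemma same_orbit_qldiv x y z : same_orbit x y -> same_orbit x (z ⧵ y).
Proof. by move=> [g ->]; exists (exist _ _ (translation_ldiv z (svalP g)) : G). Qed.

Lemma same_orbit_ker x y z : same_orbit x y -> x ∗ z = y ∗ z.
Proof. by move=> [g ->]; rewrite (mul_translation HQ) //; exact: svalP. Qed.

Lemma translation_fixed (g : G) x : fixed x -> sval g x = x.
Proof.
case: g => g /=; elim=> [//|y h _ IHh|y h _ IHh] fx; rewrite ?IHh //.
by apply: (@qmulI Q y); rewrite qldivK fx.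
Qed.

Lemma orbit_congruence a : congruence [::] [:: @qmul Q; @qldiv Q]
  (fun x y => x = y \/ (same_orbit a x /\ same_orbit a y)).
Proof.
apply: congruence_of_kernel => [x|x y|x y z|x y z|x y z|x y z].
- by left.
- by case=> [->|[]]; [left|right].
- by move=> [->//|[ax ay]] [<-|[_ az]]; right.
- by case=> [->//|[ax ay]]; rewrite -(same_orbit_ker z ax); exact: same_orbit_ker.
- by case=> [->|[ax ay]]; [left|right; split; exact: same_orbit_qmul].
- by case=> [->|[ax ay]]; [left|right; split; exact: same_orbit_qldiv].
Qed.

Lemma fixed_pair_congruence c d : fixed c -> fixed d -> (forall z, c ∗ z = d ∗ z) ->
  congruence [::] [:: @qmul Q; @qldiv Q]
    (fun x y => x = y \/ ((x = c \/ x = d) /\ (y = c \/ y = d))).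
Proof.
rewrite /fixed => fc fd cd.
have fV x : fixed x -> forall z, z ⧵ x = x.
  by move=> fx z; apply: (@qmulI Q z); rewrite qldivK fx.
have [fVc fVd] := (fV _ fc, fV _ fd).
apply: congruence_of_kernel => [x|x y|x y z|x y z|x y z|x y z].
- by left.
- by case=> [->|[]]; [left|right].
- by move=> [->//|[ax ay]] [<-|[_ az]]; right.
- by move=> [->|[[]-> []->]].
- by move=> [->|[[]-> []->]]; rewrite ?fc ?fd; auto 6.
- by move=> [->|[[]-> []->]]; rewrite ?fVc ?fVd; auto 6.
Qed.

Lemma fixed_pair c d : fixed c -> fixed d -> (forall z, c ∗ z = d ∗ z) ->
  c <> d -> (u = c \/ u = d) /\ (v = c \/ v = d).
Proof.
move=> fc fd cd ncd; have [|//|] := mono (fixed_pair_congruence fc fd cd).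
  by exists c, d; split=> //; auto 6.
by [].
Qed.

(** The orbit of a moved [a] has at least two elements, so the congruence collapsing it identifies
    [u] and [v], which puts [u] in that orbit. Hence only one orbit is non-trivial. *)
Lemma moved_orbit a : ~ fixed a -> same_orbit u a.
Proof.
move=> /existsNP [b ba].
have [|//|[au _]] := mono (orbit_congruence a); last exact: same_orbit_sym.
have aa : same_orbit a a by exists 0.
exists (b ∗ a), a; split=> //; right; split=> //; exact: same_orbit_qmul.
Qed.

(** If [u] were fixed, every element would be, and any two could be collapsed. Collapsing [u] with a
    third element does not identify [u] and [v], so [Q] would be finite. *)
Lemma u_moved : ~ fixed u.
Proof.
move=> fu; have allf a : fixed a.
  have [//|na] := pselect (fixed a).
  by have [g ->] := moved_orbit na; rewrite translation_fixed.
apply: infQ; apply: sub_finite_set (finite_set2 u v) => w _ /=.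
apply: contrapT => /not_orP[wu wv].
have [|_ []/esym//] := @fixed_pair u w (allf _) (allf _) _ (nesym wu).
  by move=> z; rewrite !allf.
Qed.

Lemma v_orbit : same_orbit u v.
Proof.
have /existsNP[b bu] := u_moved.
have uu : same_orbit u u by exists 0.
have [|//|[]//] := mono (orbit_congruence u).
exists (b ∗ u), u; split=> //; right; split=> //; exact: same_orbit_qmul.
Qed.

Lemma orbit_moved (g : G) : ~ fixed (sval g u).
Proof.
move=> fx; have /same_orbit_sym[h E] : same_orbit u (sval g u) by exists g.
by apply: u_moved; rewrite E translation_fixed.
Qed.

Lemma fixed_inj c d : fixed c -> fixed d -> (forall z, c ∗ z = d ∗ z) -> c = d.
Proof.
move=> fc fd cd; apply: contrapT => ncd.
by have [[E|E] _] := fixed_pair fc fd cd ncd; apply: u_moved; rewrite E.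
Qed.

(** On a moved point h(u), L_a equals L_u, which commutes with h and fixes [u]. *)
Lemma moved_translation a : ~ fixed a -> left_translation HQ a = 0.
Proof.
move=> na; apply: tr_eq => z /=.
have [fz|/moved_orbit[h ->]] := pselect (fixed z); first exact: fz.
rewrite -(same_orbit_ker _ (moved_orbit na)).
by rewrite -(translationM HQ _ _ (svalP h)) qmulxx.
Qed.

Lemma translation_regular (g h : G) : sval g u = sval h u -> g = h.
Proof.
move=> E; apply: tr_eq => z.
have [fz|/moved_orbit[k ->]] := pselect (fixed z); first by rewrite !translation_fixed.
have comm (l : G) : sval l (sval k u) = sval k (sval l u).
  by apply: (translation_comm HQ); exact: svalP.
by rewrite !comm E.
Qed.

(** Take for [m] the translation from [u] to [v]. The orbits of the subgroup generated by a non-zero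
    [x] form a non-trivial congruence, so some multiple of [x] takes [u] to [v]; by regularity it is
    [m]. *)
Lemma translation_group_si :
  exists2 m : G, m != 0 & forall x : G, x != 0 -> multiple_of x m.
Proof.
have [m vm] := v_orbit; exists m.
  by apply: contra_not_neq uv => m0; rewrite vm m0.
move=> x x0; pose R y z := exists n : int, z = sval (x *~ n) y.
suff [n E] : R u v by exists n; apply: translation_regular; rewrite -vm.
apply: mono; last first.
  exists u, (sval x u); split; last by exists 1.
  by move=> E; apply/negP: x0; rewrite negbK; apply/eqP/translation_regular.
apply: congruence_of_kernel => [y|y z|y z t|y z t|y z t|y z t].
- by exists 0.
- move=> [n ->]; exists (- n).
  by rewrite -[RHS]/(sval (x *~ - n + x *~ n) y) -mulrzDr addNr.
- move=> [n ->] [l ->]; exists (l + n).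
  by rewrite mulrzDr.
- by move=> [n ->]; apply: same_orbit_ker; exists (x *~ n).
- by move=> [n ->]; exists n; rewrite (translationM HQ) //; exact: svalP.
- by move=> [n ->]; exists n; rewrite (translationV HQ) //; exact: svalP.
Qed.

(** [Q] embeds into [G * bool]: a fixed point is coded by its left translation, a moved one by a
    translation taking [u] to it. *)
Lemma infinite_translation_group : infinite_set [set: G].
Proof.
have /choice[f fP] (x : Q) : exists w : G * bool,
    if w.2 then fixed x /\ w.1 = left_translation HQ x else x = sval w.1 u.
  have [fx|/moved_orbit[g E]] := pselect (fixed x).
    by exists (left_translation HQ x, true).
  by exists (g, false).
have f_inj : injective f.
  move=> x y E; move: (fP x) (fP y); rewrite -E.
  case: (f x) => g [] /=; last by move=> -> ->.
  move=> [fx gx] [fy gy]; apply: fixed_inj => // z.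
  have xy : left_translation HQ x = left_translation HQ y by rewrite -gx.
  by move/(congr1 (fun g : G => sval g z)): xy.
move=> finG; apply: infQ.
have -> : [set: Q] = f @^-1` setT by rewrite preimage_setT.
apply: finite_preimage; first by move=> ? ? _ _; exact: f_inj.
rewrite -setXTT; exact: finite_setX.
Qed.

(** Moved points translate trivially, so fixed points supply all generators. If these were finitely
    many, one power of [p] would kill all of [G]. *)
Lemma infinite_fixed (p : nat) (s : nat -> G) : prime p -> prufer_seq p s ->
  infinite_set [set g : G | exists2 c, fixed c & g = left_translation HQ c].
Proof.
move=> pp sP /(finite_prufer_killed sP)[k killed].
have kill_tr x : left_translation HQ x *+ p ^ k = 0.
  have [fx|nx] := pselect (fixed x); first by apply: killed; exists x.
  by rewrite moved_translation // mul0rn.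
have kill_all (g : G) : g *+ p ^ k = 0.
  suff /(_ _ (svalP g)) [h hg hk] : forall f, translation f ->
      exists2 h : G, sval h = f & h *+ p ^ k = 0.
    by rewrite (_ : g = h) //; apply: tr_eq => x; rewrite hg.
  move=> f; elim=> [|x f' _ [h <- hk]|x f' _ [h <- hk]].
  - by exists 0; rewrite ?mul0rn.
  - by exists (left_translation HQ x + h); rewrite // mulrnDl kill_tr hk addr0.
  - exists (h - left_translation HQ x); last by rewrite mulrnBl kill_tr hk subrr.
    apply/funext => y; apply: (@qmulI Q x).
    rewrite qldivK -[LHS]/(sval (left_translation HQ x + (h - left_translation HQ x)) y).
    by rewrite addrC subrK.
by have := prufer_seq_top sP k; rewrite kill_all eqxx.
Qed.

End SIStructure.

(** * The quandles [SIQ A 1 C] *)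

Lemma inj_surj_bijective (X Y : Type) (h : X -> Y) :
  injective h -> (forall y, exists x, h x = y) -> bijective h.
Proof.
move=> hi hs; have [g gK] := choice hs.
by exists g => // x; apply: hi; rewrite gK.
Qed.

Section SIQId.
Variables (A : zmodType) (C : set A).
Local Notation Q := (SIQ (id_aut A) C).
Local Notation fiber := ({a : A | range (siq_phi (id_aut A)) a} * {c : A | C c})%type.

Lemma siq_phi_id a : siq_phi (id_aut A) a = 0.
Proof. exact: subrr. Qed.

(** As φ = 0, the first coordinate of a fibre point is always 0. *)
Lemma siq_fiber_eq (y z : fiber) : sval y.2 = sval z.2 -> inr y = inr z :> Q.
Proof.
case: y z => [[b Rb] [i Ci]] [[c Rc] [j Cj]] /= E; subst j.
rewrite (Prop_irrelevance Ci Cj); apply: siq_inr_eq => /=.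
by have [x _ <-] := Rb; have [y _ <-] := Rc; rewrite !siq_phi_id.
Qed.

Lemma siq_mul_fiber (x : Q) (y : fiber) : x ∗ (inr y : Q) = inr y.
Proof. by case: x y => [a|[a i]] [b j]; apply: siq_fiber_eq. Qed.

Lemma siq_mul_base a b : (inl a : Q) ∗ (inl b : Q) = inl b.
Proof. by rewrite /= siq_phi_id add0r. Qed.

Lemma siq_mul_fiber_base (x : fiber) b : (inr x : Q) ∗ (inl b : Q) = inl (b + sval x.2).
Proof.
case: x => [[a Ra] i] /=; have [c _ Ec] := Ra.
by rewrite -Ec siq_phi_id add0r.
Qed.

Lemma siq_commuting_translations : commuting_translations Q.
Proof.
split=> x y [a|z]; rewrite ?siq_mul_fiber //; case: x y => [b|x] [c|y];
  by rewrite ?(siq_mul_fiber, siq_mul_fiber_base, siq_mul_base) // addrAC.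
Qed.

Lemma siq_fiberP (i : A) : C i -> exists y : fiber, sval y.2 = i.
Proof.
move=> Ci; have R0 : range (siq_phi (id_aut A)) 0 by exists 0; rewrite ?siq_phi_id.
by exists (exist _ _ R0, exist _ i Ci).
Qed.

Lemma infinite_siq : infinite_set C -> infinite_set [set: Q].
Proof.
move=> infC finQ; apply: infC.
pose f (x : Q) : A := if x is inr y then sval y.2 else 0.
apply: sub_finite_set (finite_image f finQ) => i /siq_fiberP[y <-].
by exists (inr y).
Qed.

End SIQId.

Lemma siq_prufer_si (p : nat) (C : set (prufer p)) : prime p -> infinite_set C ->
  infinite_si_2reductive_medial (SIQ (id_aut (prufer p)) C).
Proof.
move=> pp infC; have [s sP] := prufer_prufer_seq pp.
have [redQ medQ] := (two_reductive_medialP _).2 (siq_commuting_translations C).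
split=> //; first exact: infinite_siq.
apply/subdirectly_irreducibleP; exists (inl (s 1%N)), (inl 0); split.
  by move=> [] /eqP; apply/negP/(prufer_seq1 sP).
move=> R [refl sym trans _ cong] ntR.
have mulR x y z t : R x y -> R z t -> R (x ∗ z) (y ∗ t) by apply: cong; left.
have ldivR x y z t : R x y -> R z t -> R (x ⧵ z) (y ⧵ t) by apply: cong; right; left.
have base a b : a <> b -> R (inl a) (inl b) -> R (inl (s 1%N)) (inl 0).
  move=> ab Rab.
  (* The equivalence makes the shifts preserving [R] on the base a subgroup. It contains [C], hence
     is everything, so [R] restricts to a group congruence. *)
  pose H g := forall a b, R (inl a) (inl b) <-> R (inl (a + g)) (inl (b + g)).
  have HT g : H g.
    have : generated_subgroup C g by rewrite (infinite_subset_generates pp sP).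
    apply; split; first split.
    - by move=> c d; rewrite !addr0.
    - by move=> g1 g2 H1 H2 c d; rewrite !addrA (H2 (c + g1 - g2)) !subrK -(H1 c).
    - move=> i /siq_fiberP[y <-] c d; rewrite -!(siq_mul_fiber_base y).
      split=> [|/(ldivR _ _ _ _ (refl (inr y)))]; first exact: mulR (refl _).
      by rewrite !qmulK.
  have [|n ->] := @prufer_seq_multiple _ _ _ pp sP 0 (a - b).
    by rewrite mulr1n subr_eq0; exact/eqP.
  apply: (@congruence_multiples _ (fun c d => R (inl c) (inl d))) => //; split.
  + by move=> c; exact: refl.
  + by move=> c d; exact: sym.
  + by move=> c d e; exact: trans.
  + move=> f [<-|[]] c d Rcd; apply/(HT (c + d)).
    by rewrite addKr addrCA addNr addr0; exact: sym.
  + move=> f [<-|[]] c d e g Rcd Reg; apply: (trans _ (inl (d + e))).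
      exact: (HT e c d).1.
    by rewrite ![d + _]addrC; exact: (HT d e g).1.
(* A shift by a non-zero element of [C] moves the base point and fixes the fibre point, so two
   distinct base points become related. *)
have unfixed (a : prufer p) y : R (inl a) (inr y) -> R (inl (s 1%N)) (inl 0).
  move=> Ray; have [c Cc] := infinite_prufer_unkilled pp sP 0 infC.
  rewrite mulr1n; move: Cc => /siq_fiberP[z <-] /eqP z0.
  apply: (base a (a + sval z.2)); first by rewrite -[X in X <> _]addr0 => /addrI /esym.
  apply: (trans _ _ _ Ray); apply: sym; rewrite -(siq_mul_fiber_base z).
  by rewrite -(siq_mul_fiber (inr z) y); exact: mulR (refl _) Ray.
move: ntR => [[a|x] [[b|y] [xy Rxy]]].
- by apply: base Rxy => ab; apply: xy; rewrite ab.
- exact: unfixed Rxy.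
- exact/unfixed/sym/Rxy.
(* Two related fibre points shift 0 to distinct related base points. *)
- have := mulR _ _ _ _ Rxy (refl (inl 0)); rewrite !siq_mul_fiber_base !add0r.
  by apply: base => E; apply: xy; exact: siq_fiber_eq.
Qed.

Lemma infinite_si_isomorphic_siq (Q : quandle) : infinite_si_2reductive_medial Q ->
  exists (p : nat) (C : set (prufer p)),
    [/\ prime p, infinite_set C & isomorphic Q (SIQ (id_aut (prufer p)) C)].
Proof.
move=> [infQ /subdirectly_irreducibleP[u [v [uv mono]]] redQ medQ].
have HQ := (two_reductive_medialP Q).1 (conj redQ medQ).
have [m m0 m_min] := translation_group_si HQ uv mono infQ.
have infG := infinite_translation_group (HQ := HQ) uv mono infQ.
have [p pp mp] := si_prime m0 m_min.
have [s sP] := si_prufer_seq m0 m_min pp mp infG.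
have [r rP] := prufer_prufer_seq pp.
have [f [f_bij fD]] := prufer_seq_iso pp sP rP.
have [f' fK f'K] := f_bij.
pose F := [set g : translation_group HQ |
  exists2 c : Q, fixed c & g = left_translation HQ c].
have infF : infinite_set F := infinite_fixed uv mono pp sP.
pose C := f @` F; exists p, C; split=> //.
  move=> finC; apply: infF; apply: sub_finite_set (finite_image f' finC) => g Fg.
  by exists (f g) => //; exists g.
set S := SIQ _ _.
(* The isomorphism sends the moved point g(u) to [f g] and a fixed point to the fibre point indexed
   by its translation. *)
have /choice[h hP] (x : Q) : exists y : S, match y with
    | inl a => exists2 g : translation_group HQ, x = sval g u & a = f g
    | inr b => fixed x /\ sval b.2 = f (left_translation HQ x) end.
  have [fx|/(moved_orbit HQ uv mono)[g E]] := pselect (fixed x); last first.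
    by exists (inl (f g)), g.
  have /siq_fiberP[b Eb] : C (f (left_translation HQ x)).
    by exists (left_translation HQ x) => //; exists x.
  by exists (inr b).
have h_moved g : h (sval g u) = inl (f g).
  have := hP (sval g u); case: (h _) => [a [k E ->]|b [fx _]].
    by congr (inl (f _)); apply/esym/(translation_regular uv mono).
  by case: (orbit_moved uv mono infQ fx).
have h_fixed c : fixed c -> exists2 b, h c = inr b & sval b.2 = f (left_translation HQ c).
  move=> fc; have := hP c; case: (h c) => [a [k E _]|b [_ Eb]]; last by exists b.
  by case: (orbit_moved uv mono infQ (g := k)); rewrite -E.
have f0 : f 0 = 0 by apply: (addrI (f 0)); rewrite -fD !addr0.
have hM : {morph h : x y / x ∗ y}.
  move=> x y; have [fy|/(moved_orbit HQ uv mono)[g ->]] := pselect (fixed y).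
    by rewrite fy; have [b -> _] := h_fixed _ fy; rewrite siq_mul_fiber.
  rewrite -[x ∗ _]/(sval (left_translation HQ x + g) u) !h_moved fD.
  have [fx|nx] := pselect (fixed x).
    have [b -> Eb] := h_fixed _ fx.
    by rewrite siq_mul_fiber_base Eb addrC.
  rewrite (moved_translation HQ uv mono nx) f0 add0r.
  by have [k ->] := moved_orbit HQ uv mono nx; rewrite h_moved siq_mul_base.
exists h; split=> //; last first.
  by move=> x y; apply: (@qmulI S (h x)); rewrite -hM !qldivK.
apply: inj_surj_bijective => [x y E|[a|b]].
- have [fx|/(moved_orbit HQ uv mono)[g Eg]] := pselect (fixed x);
    have [fy|/(moved_orbit HQ uv mono)[k Ek]] := pselect (fixed y).
  + have [b Eb bx] := h_fixed _ fx; have [c Ec cy] := h_fixed _ fy.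
    apply: (fixed_inj HQ uv mono infQ) => // z.
    have [bc] : inr b = inr c :> S by rewrite -Eb -Ec.
    have : f (left_translation HQ x) = f (left_translation HQ y) by rewrite -bx bc.
    by move/(bij_inj f_bij)/(congr1 (fun t => sval t z)).
  + by have [b Eb _] := h_fixed _ fx; move: E; rewrite Eb Ek h_moved.
  + by have [b Eb _] := h_fixed _ fy; move: E; rewrite Eb Eg h_moved.
  + by move: E; rewrite Eg Ek !h_moved => -[/(bij_inj f_bij) ->].
- by exists (sval (f' a) u); rewrite h_moved f'K.
- have [g [c fc Eg] Ef] : C (sval b.2) := svalP b.2.
  exists c; have [d -> Ed] := h_fixed _ fc.
  by apply: siq_fiber_eq; rewrite Ed -Eg.
Qed.

(** * Counting isomorphism classes *)

Lemma isomorphic_refl (Q : quandle) : isomorphic Q Q.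
Proof. by exists idfun; split=> //; exists idfun. Qed.

Lemma isomorphic_sym (Q Q' : quandle) : isomorphic Q Q' -> isomorphic Q' Q.
Proof.
move=> [f [[g fK gK] fM fD]]; exists g; split; first by exists f.
  by move=> x y; rewrite -{1}(gK x) -{1}(gK y) -fM fK.
by move=> x y; rewrite -{1}(gK x) -{1}(gK y) -fD fK.
Qed.

Lemma isomorphic_trans (Q Q' Q'' : quandle) :
  isomorphic Q Q' -> isomorphic Q' Q'' -> isomorphic Q Q''.
Proof.
move=> [f [f_bij fM fD]] [g [g_bij gM gD]]; exists (g \o f).
by split=> [|x y|x y] /=; [exact: bij_comp | rewrite fM gM | rewrite fD gD].
Qed.

Lemma isomorphic_eq (Q Q' : quandle) : isomorphic Q Q' -> isomorphic Q = isomorphic Q'.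
Proof.
move=> QQ'; apply/funext => Q''; apply/propext.
by split; apply: isomorphic_trans => //; exact: isomorphic_sym.
Qed.

(** Some left translation has order exactly 2^(k+1); using iterates alone lets isomorphisms
    transport the property. *)
Definition has_translation_order (Q : quandle) (k : nat) : Prop :=
  exists q : Q, (forall x, iter (2 ^ k.+1) (qmul q) x = x) /\
                ~ (forall x, iter (2 ^ k) (qmul q) x = x).

Lemma isomorphic_translation_order (Q Q' : quandle) k :
  isomorphic Q Q' -> has_translation_order Q k -> has_translation_order Q' k.
Proof.
move=> [f [[g fK gK] fM _]] [q [q1 q0]]; exists (f q).
have iterE n x : f (iter n (qmul q) x) = iter n (qmul (f q)) (f x).
  by elim: n => //= n IHn; rewrite fM IHn.
split=> [x|q0']; first by rewrite -(gK x) -iterE q1.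
by apply: q0 => x; apply: (can_inj fK); rewrite iterE q0'.
Qed.

(** A fibre point over c acts on the base by adding c and fixes all fibre points, while base points
    act trivially. *)
Lemma siq_translation_order (A : zmodType) (C : set A) k :
  has_translation_order (SIQ (id_aut A) C) k <->
  exists2 c, C c & c *+ 2 ^ k.+1 = 0 /\ c *+ 2 ^ k != 0.
Proof.
set Q := SIQ _ _.
have iter_fiber n (q : Q) y : iter n (qmul q) (inr y) = inr y.
  by elim: n => // n IHn; rewrite iterS IHn siq_mul_fiber.
have iter_base n z a : iter n (qmul (inr z : Q)) (inl a) = inl (a + sval z.2 *+ n).
  elim: n => [|n IHn]; first by rewrite addr0.
  by rewrite iterS IHn siq_mul_fiber_base mulrSr addrA.
split=> [[[a|z] [z1 z0]]|[c /siq_fiberP[z <-] [z1 z0]]].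
- case: z0 => -[b|y]; last exact: iter_fiber.
  by elim: (2 ^ k)%N => // n IHn; rewrite iterS IHn siq_mul_base.
- exists (sval z.2); first exact: svalP.
  split; first by have := z1 (inl 0); rewrite iter_base add0r => -[].
  apply: contra_notN z0 => /eqP z0 [a|y]; last exact: iter_fiber.
  by rewrite iter_base z0 addr0.
- exists (inr z); split=> [[a|y]|z0']; rewrite ?iter_fiber ?iter_base ?z1 ?addr0 //.
  by move: z0; have := z0' (inl 0); rewrite iter_base add0r => -[->]; rewrite eqxx.
Qed.

(* Elements of order [2 ^ k.+1] for [k] even make the set infinite, those for
   [k] odd encode [S]. *)
Definition order_coded_set (S : nat -> bool) : set (prufer 2) :=
  [set x | exists k, [/\ x *+ 2 ^ k.+1 = 0, x *+ 2 ^ k != 0 & odd k -> S k./2]].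

Lemma pow_order_inj (A : zmodType) (x : A) (p k l : nat) :
  x *+ p ^ k.+1 = 0 -> x *+ p ^ k != 0 -> x *+ p ^ l.+1 = 0 -> x *+ p ^ l != 0 -> k = l.
Proof.
have absurd (i j : nat) : (i < j)%N -> x *+ p ^ i.+1 = 0 -> x *+ p ^ j != 0 -> False.
  by move=> /subnKC <- xi; rewrite expnD mulrnA xi mul0rn eqxx.
move=> xk1 xk xl1 xl; have [kl|lk|//] := ltngtP k l.
  by case: (absurd _ _ kl xk1 xl).
by case: (absurd _ _ lk xl1 xk).
Qed.

Lemma infinite_order_coded_set (S : nat -> bool) : infinite_set (order_coded_set S).
Proof.
have [s sP] := prufer_prufer_seq (isT : prime 2).
move=> /(finite_prufer_killed sP)[k killed].
(* The index [k.*2] is even, so this element lies in the set whatever [S] is, while its order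
   exceeds 2^k. *)
have sk : s k.*2.+1 *+ 2 ^ k = 0.
  apply: killed; exists k.*2.
  by split; [exact: prufer_seq_tors | exact: prufer_seq_top | rewrite odd_double].
have := prufer_seq_top sP k.*2.
by rewrite -[X in (_ ^ X)%N]addnn expnD mulrnA sk mul0rn eqxx.
Qed.

Lemma order_coded_setP (S : nat -> bool) n :
  S n <-> has_translation_order (SIQ (id_aut (prufer 2)) (order_coded_set S)) n.*2.+1.
Proof.
rewrite siq_translation_order; split=> [Sn|[c [k [k1 k0 Sk]] [n1 n0]]].
  have [s sP] := prufer_prufer_seq (isT : prime 2).
  exists (s n.*2.+2); last by split; [exact: prufer_seq_tors | exact: prufer_seq_top].
  exists n.*2.+1; split; [exact: (prufer_seq_tors sP) | exact: (prufer_seq_top sP) | ].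
  by move=> _; rewrite /= uphalf_double.
move: Sk; rewrite (pow_order_inj k1 k0 n1 n0) /= odd_double uphalf_double.
exact.
Qed.

Lemma prufer_enumeration (p : nat) :
  exists e : nat -> prufer p, prime p -> forall x, exists n, e n = x.
Proof.
have [pp|np] := pselect (prime p); last by exists (fun=> 0).
have [s sP] := prufer_prufer_seq pp.
exists (fun j => if unpickle j is Some (k, n) then s k *~ n else 0) => _ x.
have [k [n ->]] := prufer_seq_gen sP x.
by exists (pickle (k, n)); rewrite pickleK.
Qed.

Lemma prufer_subset_code : exists code : {p : nat & set (prufer p)} -> nat -> bool,
  forall d d', prime (tag d) -> prime (tag d') -> code d = code d' -> d = d'.
Proof.
pose e p := sval (cid (prufer_enumeration p)).
have eP p : prime p -> forall x, exists n, e p n = x.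
  exact: (svalP (cid (prufer_enumeration p))).
(* Even positions hold the indicator of the prime, odd ones that of the subset along the
   enumeration. *)
exists (fun d n => if odd n then `[< (tagged d : set (prufer _)) (e (tag d) n./2) >]
                   else n./2 == tag d).
move=> [p C] [q D] /= pp _ E; have pq : p = q.
  have := congr1 (fun c => c p.*2) E.
  by rewrite /= odd_double doubleK eqxx => /esym/eqP.
subst q; congr existT; apply/funext => x; have [n <-] := eP p pp x.
have := congr1 (fun c => c n.*2.+1) E.
by rewrite /= odd_double uphalf_double /= => CD; exact: propext (asbool_eq_equiv CD).
Qed.

(** Cantor-Bernstein is applied to the image of [f] inside [nat -> bool], so that only sets of
    sequences are compared. *)
Lemma inj_inj_bijective (X : Type) (f : X -> nat -> bool) (g : (nat -> bool) -> X) :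
  injective f -> injective g -> exists h : X -> nat -> bool, bijective h.
Proof.
move=> f_inj g_inj; pose imf := [set y | exists x, f x = y].
have cardI : (imf #= [set: nat -> bool])%card.
  apply: Cantor_Bernstein; first exact: card_leT.
  apply/card_subP; exists (range (f \o g)).
    by apply: inj_card_eq => y z _ _ /f_inj/g_inj.
  by move=> _ [y _ <-]; exists (g y).
have /card_set_bijP[b [_ b_inj b_surj]] := cardI.
exists (b \o f); apply: inj_surj_bijective => [x y /b_inj E|y].
  by apply: f_inj; apply: E; rewrite inE; eexists.
by have [_ [x <-] bx] := b_surj y I; exists x.
Qed.

Theorem theorem9p4 :
  (forall Q : quandle, infinite_si_2reductive_medial Q ->
     exists (p : nat) (C : set (prufer p)),
       [/\ prime p, infinite_set C, siq_admissible (id_aut (prufer p)) C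
         & isomorphic Q (SIQ (id_aut (prufer p)) C)])
  /\ (exists f : iso_classes infinite_si_2reductive_medial -> (nat -> bool),
        bijective f).
Proof.
split.
  move=> Q /infinite_si_isomorphic_siq[p [C [pp infC QC]]]; exists p, C; split=> //.
  by have [s sP] := prufer_prufer_seq pp; exact: prufer_admissible pp sP C infC.
have [code codeI] := prufer_subset_code.
pose siq (d : {p : nat & set (prufer p)}) := SIQ (id_aut (prufer (tag d))) (tagged d).
(* Upper bound: a class is determined by any pair (p, C) representing it, so coding a chosen pair is
   injective. *)
have /choice[d dP] (K : iso_classes infinite_si_2reductive_medial) :
    exists d, prime (tag d) /\ sval K = isomorphic (siq d).
  have [Q /infinite_si_isomorphic_siq[p [C [pp _ QC]]] EK] := svalP K.
  by exists (existT _ p C); split=> //; rewrite EK; exact: isomorphic_eq.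
(* Lower bound: [S] is recovered from the orders of the left translations. *)
pose siq2 S := SIQ (id_aut (prufer 2)) (order_coded_set S).
have siq2P S : infinite_si_2reductive_medial (siq2 S).
  by apply: siq_prufer_si => //; exact: infinite_order_coded_set.
pose g S : iso_classes infinite_si_2reductive_medial :=
  exist _ _ (ex_intro2 _ _ (siq2 S) (siq2P S) erefl).
apply: (@inj_inj_bijective _ (code \o d) g) => [K K' E|S S' [E]].
  have [[pK EK] [pK' EK']] := (dP K, dP K').
  move: E => /(codeI _ _ pK pK') E; rewrite E -EK' in EK.
  by case: K K' EK {E dP pK EK' pK'} => [K HK] [K' HK'] /= E; exact: eq_exist.
have SS' : isomorphic (siq2 S) (siq2 S') by rewrite E; exact: isomorphic_refl.
apply/funext => n; apply/idP/idP => /order_coded_setP Sn; apply/order_coded_setP.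
  exact: isomorphic_translation_order Sn.
exact: isomorphic_translation_order (isomorphic_sym SS') Sn.
Qed.
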